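(* For variables $a,b,\alpha,\beta$, any natural number $n\ge1$ and any admissible $r$ ($0\le r\le\lfloor n/2\rfloor$ for $\Psi$, $0\le r\le\lfloor (n-1)/2\rfloor$ for $\Phi$), \[ \Psi\left(\begin{array}{cc|c} a & b & n \\ \alpha & \beta & r \end{array}\right)=\frac{(-1)^r}{r!}\Big(\alpha\frac{\partial}{\partial a}+\beta\frac{\partial}{\partial b}\Big)^r\Psi(a,b,n)=\frac{(-1)^r}{(\lfloor n/2\rfloor-r)!}\Big(a\frac{\partial}{\partial \alpha}+b\frac{\partial}{\partial \beta}\Big)^{\lfloor n/2\rfloor-r}\Psi(\alpha,\beta,n), \] \[ \Phi\left(\begin{array}{cc|c} a & b & n \\ \alpha & \beta & r \end{array}\right)=\frac{(-1)^r}{r!}\Big(\alpha\frac{\partial}{\partial a}+\beta\frac{\partial}{\partial b}\Big)^r\Phi(a,b,n)=\frac{(-1)^r}{(\lfloor (n-1)/2\rfloor-r)!}\Big(a\frac{\partial}{\partial \alpha}+b\frac{\partial}{\partial \beta}\Big)^{\lfloor (n-1)/2\rfloor-r}\Phi(\alpha,\beta,n). \]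
   Context: $\delta(m)=1$ for $m$ odd, $0$ for $m$ even; $\lfloor\cdot\rfloor$ is the floor. $\Psi(a,b,n)$, $\Phi(a,b,n)$ are the polynomials in $a,b$ defined by $\Psi(a,b,0)=2$, $\Psi(a,b,1)=1$, $\Psi(a,b,n+1)=(2a-b)^{\delta(n)}\Psi(a,b,n)-a\Psi(a,b,n-1)$ and $\Phi(a,b,0)=0$, $\Phi(a,b,1)=1$, $\Phi(a,b,n+1)=(2a-b)^{\delta(n+1)}\Phi(a,b,n)-a\Phi(a,b,n-1)$. For indeterminates $a,b,\alpha,\beta$ and $n\ge1$, $\Psi\left(\begin{array}{cc|c} a & b & n \\ \alpha & \beta & r \end{array}\right)$ and $\Phi\left(\begin{array}{cc|c} a & b & n \\ \alpha & \beta & r \end{array}\right)$ are the unique polynomials in $\mathbb{Z}[a,b,\alpha,\beta]$ such that, identically in $x,y$, $(\beta a-\alpha b)^{\lfloor n/2\rfloor}\frac{x^n+y^n}{(x+y)^{\delta(n)}}=\sum_{r=0}^{\lfloor n/2\rfloor}\Psi\left(\begin{array}{cc|c} a & b & n \\ \alpha & \beta & r \end{array}\right)(\alpha x^2+\beta xy+\alpha y^2)^{\lfloor n/2\rfloor-r}(ax^2+bxy+ay^2)^r$ and $(\beta a-\alpha b)^{\lfloor (n-1)/2\rfloor}\frac{x^n-y^n}{(x-y)(x+y)^{\delta(n-1)}}=\sum_{r=0}^{\lfloor (n-1)/2\rfloor}\Phi\left(\begin{array}{cc|c} a & b & n \\ \alpha & \beta & r \end{array}\right)(\alpha x^2+\beta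 xy+\alpha y^2)^{\lfloor (n-1)/2\rfloor-r}(ax^2+bxy+ay^2)^r$. *)

(* Defs.v *)
From HB Require Import structures.
From mathcomp Require Import all_boot all_order all_algebra.
From mathcomp Require Import mpoly.
Set Implicit Arguments. Unset Strict Implicit. Unset Printing Implicit Defensive.
Import Order.TTheory GRing.Theory Num.Theory.
Local Open Scope ring_scope.

Definition delta (m : nat) : nat := odd m.

Fixpoint Psi2 (R : comRingType) (a b : R) (n : nat) : R * R :=
  match n with
  | 0 => (2%:R, 1)
  | k.+1 => let: (p, q) := Psi2 a b k in
            (q, (2%:R * a - b) ^+ delta k.+1 * q - a * p)
  end.
(* Psi(a,b,0)=2, Psi(a,b,1)=1, Psi(n+1) = (2a-b)^delta(n) Psi(n) - a Psi(n-1) *)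
Definition Psi (R : comRingType) (a b : R) (n : nat) : R := (Psi2 a b n).1.

Fixpoint Phi2 (R : comRingType) (a b : R) (n : nat) : R * R :=
  match n with
  | 0 => (0, 1)
  | k.+1 => let: (p, q) := Phi2 a b k in
            (q, (2%:R * a - b) ^+ delta k.+2 * q - a * p)
  end.
(* Phi(a,b,0)=0, Phi(a,b,1)=1, Phi(n+1) = (2a-b)^delta(n+1) Phi(n) - a Phi(n-1) *)
Definition Phi (R : comRingType) (a b : R) (n : nat) : R := (Phi2 a b n).1.

Definition va (R : comRingType) : {mpoly R[4]} := 'X_(inord 0).
Definition vb (R : comRingType) : {mpoly R[4]} := 'X_(inord 1).
Definition valpha (R : comRingType) : {mpoly R[4]} := 'X_(inord 2).
Definition vbeta (R : comRingType) : {mpoly R[4]} := 'X_(inord 3).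

Section XY.
Variable R : comRingType.
Definition PXY := {poly {poly {mpoly R[4]}}}.
Definition cst (c : {mpoly R[4]}) : PXY := c%:P%:P.
Definition vx : PXY := ('X : {poly {mpoly R[4]}})%:P.
Definition vy : PXY := 'X.
Definition qform (c1 c2 : {mpoly R[4]}) : PXY :=
  cst c1 * vx ^+ 2 + cst c2 * vx * vy + cst c1 * vy ^+ 2.
End XY.

(* c is the family Psi( a b | n ; alpha beta | r ), r = 0..floor(n/2):
   (beta a - alpha b)^floor(n/2) (x^n+y^n)/(x+y)^delta(n)
     = sum_r c_r (alpha x^2+beta xy+alpha y^2)^(floor(n/2)-r) (a x^2+b xy+a y^2)^r,
   with the (exact) division by (x+y)^delta(n) cleared. *)
Definition is_Psi_bracket (n : nat) (c : nat -> {mpoly int[4]}) : Prop :=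
  cst (vbeta int * va int - valpha int * vb int) ^+ n./2
    * (vx int ^+ n + vy int ^+ n)
  = (vx int + vy int) ^+ delta n *
    \sum_(0 <= r < n./2 + 1)
      cst (c r) * qform (valpha int) (vbeta int) ^+ (n./2 - r)
               * qform (va int) (vb int) ^+ r.

(* c is the family Phi( a b | n ; alpha beta | r ), r = 0..floor((n-1)/2):
   (beta a - alpha b)^floor((n-1)/2) (x^n-y^n)/((x-y)(x+y)^delta(n-1))
     = sum_r c_r (alpha x^2+beta xy+alpha y^2)^(floor((n-1)/2)-r) (a x^2+b xy+a y^2)^r,
   with the (exact) division cleared. *)
Definition is_Phi_bracket (n : nat) (c : nat -> {mpoly int[4]}) : Prop :=
  cst (vbeta int * va int - valpha int * vb int) ^+ (n.-1)./2
    * (vx int ^+ n - vy int ^+ n)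
  = (vx int - vy int) * (vx int + vy int) ^+ delta n.-1 *
    \sum_(0 <= r < (n.-1)./2 + 1)
      cst (c r) * qform (valpha int) (vbeta int) ^+ ((n.-1)./2 - r)
               * qform (va int) (vb int) ^+ r.

Definition Dab (p : {mpoly rat[4]}) : {mpoly rat[4]} :=
  valpha rat * p^`M(inord 0) + vbeta rat * p^`M(inord 1).
Definition Dalphabeta (p : {mpoly rat[4]}) : {mpoly rat[4]} :=
  va rat * p^`M(inord 2) + vb rat * p^`M(inord 3).

Definition toQ (p : {mpoly int[4]}) : {mpoly rat[4]} := map_mpoly (intr : int -> rat) p.

(* Main.v *)
(* Both Psi(a,b,n) and Phi(a,b,n+1) satisfy one recurrence [lucas], differ only
   in the value at 0, and are homogeneous of degree m = floor(n/2) in (a,b).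
   Put u = alpha x^2 + beta xy + alpha y^2, v = a x^2 + b xy + a y^2 and
   D = beta a - alpha b.  Then a u - alpha v = D xy and
   b u - beta v = - D (x^2 + y^2), and for W = Psi or Phi the value
   W(xy, - x^2 - y^2) is the quotient on the left of the defining expansion, so
   this left side is W(a u - alpha v, b u - beta v).  Taylor expansion of W at
   (a,b) in the direction (alpha,beta), or at (alpha,beta) in the direction
   (a,b), gives the two formulas; the coefficients are unique because u and v
   are coprime as polynomials in y after setting x = 1. *)
Require Import Defs.
From HB Require Import structures.
From mathcomp Require Import all_boot all_order all_algebra.
From mathcomp Require Import mpoly ring zify.
Import Order.TTheory GRing.Theory Num.Theory.
Local Open Scope ring_scope.

(** * The recurrence common to both families *)

Fixpoint lucas {R : comNzRingType} (c : nat) (a b : R) (n : nat) : R :=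
  match n with
  | 0 => c%:R
  | n'.+1 => if n' is n''.+1 then
      (2%:R * a - b) ^+ delta n' * lucas c a b n' - a * lucas c a b n''
    else 1
  end.

Lemma two_step_ind (P : nat -> Prop) :
  P 0 -> P 1 -> (forall n, P n -> P n.+1 -> P n.+2) -> forall n, P n.
Proof.
move=> P0 P1 PS n; suff [] : P n /\ P n.+1 by [].
by elim: n => [|n [IH1 IH2]]; split=> //; apply: PS.
Qed.

Lemma lucasSS (R : comNzRingType) c (a b : R) n :
  lucas c a b n.+2 =
    (2%:R * a - b) ^+ delta n.+1 * lucas c a b n.+1 - a * lucas c a b n.
Proof. by []. Qed.

(** Degree count behind homogeneity and the size bound: the factor raised to [delta n.+1]
    contributes exactly the growth of the half. *)
Lemma half_delta n : (n.+2./2 = delta n.+1 + n.+1./2)%N.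
Proof. by rewrite /delta /=; lia. Qed.

Lemma PsiE (R : comNzRingType) (a b : R) n : Psi a b n = lucas 2 a b n.
Proof.
rewrite /Psi; suff -> : Psi2 a b n = (lucas 2 a b n, lucas 2 a b n.+1) by [].
by elim: n => [|n IH] //; rewrite lucasSS /= IH.
Qed.

(** The shift by one matches the initial values and the parities, since [delta n.+3] equals
    [delta n.+1]. *)
Lemma PhiE (R : comNzRingType) (a b : R) n : Phi a b n.+1 = lucas 1 a b n.
Proof.
rewrite /Phi; suff -> : Phi2 a b n.+1 = (lucas 1 a b n, lucas 1 a b n.+1) by [].
elim: n => [|n IH]; first by rewrite /= mulr0 subr0 expr0 mul1r.
have -> : Phi2 a b n.+2 = (lucas 1 a b n.+1,
   (2%:R * a - b) ^+ delta n.+3 * lucas 1 a b n.+1 - a * lucas 1 a b n).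
  by move: IH => /= ->.
by rewrite lucasSS /delta /= !negbK.
Qed.

Lemma rmorph_lucas (R S : comNzRingType) (f : {rmorphism R -> S}) c (a b : R) n :
  f (lucas c a b n) = lucas c (f a) (f b) n.
Proof.
elim/two_step_ind: n => [||n IH1 IH2].
- by rewrite rmorph_nat.
- by rewrite rmorph1.
- by rewrite !lucasSS rmorphB !rmorphM rmorphXn rmorphB rmorphM rmorph_nat IH1 IH2.
Qed.

Lemma lucas_homog (R : comNzRingType) c (l a b : R) n :
  lucas c (l * a) (l * b) n = l ^+ n./2 * lucas c a b n.
Proof.
elim/two_step_ind: n => [||n IH1 IH2].
- by rewrite mul1r.
- by rewrite mul1r.
- rewrite !lucasSS IH1 IH2 mulrBr; congr (_ - _); last by rewrite /= exprS; ring.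
  rewrite half_delta exprD.
  have -> : 2%:R * (l * a) - l * b = l * (2%:R * a - b) by ring.
  by rewrite exprMn; ring.
Qed.

Lemma pred_addn_leq m k i j :
  (m <= i.+1)%N -> (k <= j.+1)%N -> ((m + k).-1 <= (i + j).+1)%N.
Proof. lia. Qed.

Lemma size_lucas (R : comNzRingType) c (p q : {poly R}) n :
  (size p <= 2)%N -> (size q <= 2)%N -> (size (lucas c p q n) <= n./2.+1)%N.
Proof.
move=> sp sq; elim/two_step_ind: n => [||n IH1 IH2].
- by rewrite /= -polyC_natr size_polyC_leq1.
- by rewrite size_poly1.
- rewrite lucasSS (leq_trans (size_polyD _ _))// size_polyN geq_max.
  have s2 : (size (2%:R * p - q)%R <= 2)%N.
    rewrite (leq_trans (size_polyD _ _))// size_polyN geq_max sq andbT.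
    by rewrite -mulrC mulr_natr -scaler_nat (leq_trans (size_scale_leq _ _)).
  apply/andP; split; last first.
    by rewrite (leq_trans (size_polyMleq _ _))//= (@pred_addn_leq _ _ 1 _ sp IH1).
  rewrite half_delta (leq_trans (size_polyMleq _ _))//.
  rewrite /delta; case: (odd _) => /=.
    by rewrite expr1 (@pred_addn_leq _ _ 1 _ s2 IH2).
  by rewrite expr0 size_poly1.
Qed.

(** A derivation kills the integers, so once it kills [p] and [q] it kills every integer polynomial
    in them. *)
Lemma lucas_derivation (R : comNzRingType) (E : R -> R) c (p q : R) n :
  (forall f g, E (f - g) = E f - E g) ->
  (forall f g, E (f * g) = E f * g + f * E g) ->
  E p = 0 -> E q = 0 -> E (lucas c p q n) = 0.
Proof.
move=> EB EM Ep Eq.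
have E0 : E 0 = 0 by have := EB 0 0; rewrite !subrr.
have EN f : E (- f) = - E f by rewrite -sub0r EB E0 sub0r.
have ED f g : E (f + g) = E f + E g by rewrite -{1}(opprK g) EB EN opprK.
have E1 : E 1 = 0.
  by have /eqP := EM 1 1; rewrite !mulr1 mul1r addrC -subr_eq subrr eq_sym => /eqP.
have En k : E k%:R = 0 by elim: k => // k IH; rewrite -natr1 ED IH E1 addr0.
elim/two_step_ind: n => [||n IH1 IH2]; [exact: En | exact: E1 |].
rewrite lucasSS EB !EM IH1 IH2 Ep !mulr0 mul0r !addr0 subr0.
suff -> : E ((2%:R * p - q) ^+ delta n.+1) = 0 by rewrite mul0r.
by rewrite /delta; case: (odd _); rewrite ?expr1 // EB EM En Ep Eq mul0r mulr0 addr0 subr0.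
Qed.

(** At these arguments [2a - b] is [(x + y) ^+ 2], and the factor [(x + y) ^+ delta n] absorbs the
    parity, leaving the constant-coefficient recurrence of [s]. Taking [z = 1] serves the sums of
    powers, [z = x - y] the differences. *)
Lemma lucas_xy (R : comNzRingType) c (x y z : R) (s : nat -> R) n :
  s 0%N = c%:R * z -> s 1%N = (x + y) * z ->
  (forall n, s n.+2 = (x + y) * s n.+1 - x * y * s n) ->
  z * (x + y) ^+ delta n * lucas c (x * y) (- (x ^+ 2 + y ^+ 2)) n = s n.
Proof.
move=> s0 s1 sS; elim/two_step_ind: n => [||n IH1 IH2].
- by rewrite s0 /delta /= expr0; ring.
- by rewrite s1 /delta /= expr1; ring.
- rewrite sS -IH1 -IH2 lucasSS.
  have -> : 2%:R * (x * y) - - (x ^+ 2 + y ^+ 2) = (x + y) ^+ 2 by ring.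
  by rewrite /delta /=; case: (odd n); rewrite /= ?expr0 ?expr1; ring.
Qed.

(** * Expansion along a line and Taylor coefficients *)

Lemma size_linear (R : comNzRingType) (p q : R) :
  (size (p%:P + q *: 'X)%R <= 2)%N.
Proof.
rewrite (leq_trans (size_polyD _ _))// geq_max (leq_trans (size_polyC_leq1 _))//=.
by rewrite (leq_trans (size_scale_leq _ _))// size_polyX.
Qed.

(* Dehomogenizing by [t = V / U] turns the left side into [U ^+ n./2 * F.[t]]. *)
Lemma lucas_expand (R : comNzRingType) (A : idomainType) (f : {rmorphism R -> A})
    c (p q p' q' : R) (U V : A) n : U != 0 ->
  lucas c (f p * U + f q * V) (f p' * U + f q' * V) n =
  \sum_(r < n./2.+1)
     f (lucas c (p%:P + q *: 'X) (p'%:P + q' *: 'X) n)`_r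
       * U ^+ (n./2 - r) * V ^+ r.
Proof.
move=> U0; apply/eqP; rewrite -tofrac_eq; apply/eqP.
(* The ratio [V / U] exists only in the fraction field, into which [A] embeds. *)
set g : {rmorphism R -> {fraction A}} := (@tofrac A) \o f.
have U0' : tofrac U != 0 by rewrite tofrac_eq0.
set t := tofrac V / tofrac U.
rewrite rmorph_lucas !rmorphD !rmorphM /=.
have E (x y : R) : tofrac (f x) * tofrac U + tofrac (f y) * tofrac V
    = tofrac U * (map_poly g (x%:P + y *: 'X)).[t].
  rewrite rmorphD /= map_polyC map_polyZ map_polyX /= hornerD hornerC hornerZ hornerX.
  rewrite mulrDr (mulrC (tofrac U)) [tofrac U * (_ * t)]mulrCA.
  by rewrite [tofrac U * t]mulrC divfK.
rewrite !E lucas_homog -!horner_evalE -!rmorph_lucas.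
rewrite /= horner_evalE.
(* The size bound allows exactly [n./2.+1] terms, padded by zeros if the degree drops. *)
rewrite (@horner_coef_wide _ n./2.+1); last first.
  by rewrite (leq_trans (size_poly _ _))//; apply: size_lucas; exact: size_linear.
rewrite rmorph_sum mulr_sumr; apply: eq_bigr => r _.
rewrite coef_map !rmorphM !rmorphXn /= -/g /t expr_div_n.
have -> : tofrac U ^+ n./2 = tofrac U ^+ (n./2 - r) * tofrac U ^+ r.
  by rewrite -exprD subnK// -ltnS.
rewrite mulrACA [tofrac U ^+ r * _]mulrC divfK ?expf_neq0//.
by rewrite [tofrac U ^+ _ * _]mulrC.
Qed.

Lemma map_poly_derivation (R : comNzRingType) (T : R -> R) (f g : {poly R}) :
  (forall x y, T (x + y) = T x + T y) ->
  (forall x y, T (x * y) = T x * y + x * T y) ->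
  map_poly T (f * g) = map_poly T f * g + f * map_poly T g.
Proof.
move=> TD TM.
have T0 : T 0 = 0 by apply: (addrI (T 0)); rewrite -TD !addr0.
apply/polyP => i; rewrite coefD !coefM coef_map_id0// coefM (big_morph T TD T0).
rewrite -big_split; apply: eq_bigr => j _ /=.
by rewrite TM !coef_map_id0.
Qed.

(* [d/ds] and the coefficientwise action of [T] agree on [p + q s] and
   [p' + q' s], hence on the polynomial [F] in [s], so [(k+1) F_(k+1) = T F_k]. *)
Lemma lucas_taylor (R : comNzRingType) (T : R -> R) c (p q p' q' : R) n r :
  (forall x y, T (x + y) = T x + T y) ->
  (forall x y, T (x * y) = T x * y + x * T y) ->
  T p = q -> T q = 0 -> T p' = q' -> T q' = 0 ->
  (lucas c (p%:P + q *: 'X) (p'%:P + q' *: 'X) n)`_r *+ r`!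
    = iter r T (lucas c p p' n).
Proof.
move=> TD TM Tp Tq Tp' Tq'.
set F := lucas _ _ _ _.
have T0 : T 0 = 0 by apply: (addrI (T 0)); rewrite -TD !addr0.
have TN x : T (- x) = - T x.
  by apply/eqP; rewrite -addr_eq0 -TD addNr T0.
have TMn x k : T (x *+ k) = T x *+ k.
  by elim: k => [|k IH]; rewrite ?mulr0n ?T0 // !mulrS TD IH.
(* On a linear polynomial both derivations give the constant [y]. *)
have lin x y : T x = y -> T y = 0 ->
    (x%:P + y *: 'X)^`() - map_poly T (x%:P + y *: 'X) = 0.
  move=> Tx Ty; apply/polyP => i.
  rewrite coefB coef_deriv coef_map_id0// coef0 !coefD !coefC !coefZ !coefX.
  by case: i => [|[|i]]; rewrite /= ?mulr0 ?mulr1 ?add0r ?addr0 ?mul0rn ?mulr1n ?Tx ?Ty ?T0 ?subrr.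
have FE : F^`() - map_poly T F = 0.
  apply: (@lucas_derivation _ (fun f => f^`() - map_poly T f)); last 2 first.
  - exact: lin.
  - exact: lin.
  - move=> f g; rewrite derivB.
    suff -> : map_poly T (f - g) = map_poly T f - map_poly T g by ring.
    by apply/polyP => i; rewrite coefB !coef_map_id0// coefB TD TN.
  - by move=> f g; rewrite derivM map_poly_derivation//; ring.
elim: r => [|r IH].
  (* The constant coefficient is the value at 0, and evaluation, being a ring morphism, commutes
     with [lucas]. *)
  rewrite fact0 mulr1n /= -horner_coef0 /F -horner_evalE rmorph_lucas /= !horner_evalE.
  by rewrite !hornerE ?mulr0 ?addr0.
rewrite iterS -IH TMn factS mulrnA; congr (_ *+ _).
have /(congr1 (fun f : {poly R} => f`_r))/eqP := FE.
by rewrite coefB coef_deriv coef_map_id0// coef0 subr_eq0 => /eqP.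
Qed.

(** * Uniqueness of the coefficients over an integral domain *)

(** For positive [m], [u] divides every term but the last, hence also the last; by coprimality it
    divides the constant [d m], which must vanish because [u] is not constant. Cancelling [u] then
    lowers [m] by one. *)
Lemma coprimep_form_eq0 (A : idomainType) (u v : {poly A}) (d : nat -> A) m :
  coprimep u v -> (1 < size u)%N ->
  \sum_(r < m.+1) (d r)%:P * u ^+ (m - r) * v ^+ r = 0 ->
  forall r, (r <= m)%N -> d r = 0.
Proof.
move=> uv su; elim: m => [|m IH].
  rewrite big_ord1 !expr0 !mulr1 => /eqP; rewrite polyC_eq0 => /eqP d0 r.
  by rewrite leqn0 => /eqP ->.
rewrite big_ord_recr /= subnn expr0 mulr1.
rewrite (eq_bigr (fun r : 'I_m.+1 => u * ((d r)%:P * u ^+ (m - r) * v ^+ r))).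
  rewrite -mulr_sumr => E.
  have dm : d m.+1 = 0.
    apply/eqP; apply: contraT => dm0.
    have : u %| (d m.+1)%:P.
      rewrite -(Gauss_dvdpl _ (coprimep_expr m.+1 uv)).
      by move/eqP: E; rewrite addrC addr_eq0 => /eqP ->; rewrite dvdpNr dvdp_mulIl.
    move/dvdp_leq; rewrite polyC_eq0 size_polyC dm0 => /(_ isT).
    by rewrite leqNgt su.
  move/eqP: E; rewrite dm mul0r addr0 mulf_eq0 -size_poly_eq0.
  case: (size u) su => //= _ _ /eqP/IH Hd r.
  by rewrite leq_eqVlt => /predU1P[->//|]; apply: Hd.
by move=> r _; rewrite subSn -1?ltnS// exprS; ring.
Qed.

(** Eliminating the outer coefficients leaves [(be * a - al * b) *: 'X], and ['X] is coprime to the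
    first form, whose value at 0 is [al]. *)
Lemma coprimep_forms (A : idomainType) (a b al be : A) :
  al != 0 -> be * a - al * b != 0 ->
  coprimep (al%:P + be%:P * 'X + al%:P * 'X^2) (a%:P + b%:P * 'X + a%:P * 'X^2).
Proof.
move=> al0 D0; set u := _ + _ + _; set v := _ + _ + _.
have al0' : - al != 0 by rewrite oppr_eq0.
rewrite -(coprimepZr _ _ al0') -(coprimep_addl_mul a%:P).
have -> : a%:P * u + (- al) *: v = (be * a - al * b) *: 'X.
  by rewrite -!mul_polyC /u /v polyCN polyCB !polyCM; ring.
by rewrite coprimepZr// -['X]subr0 -polyC0 coprimep_XsubC /root /u !hornerE /= !mulr0 addr0.
Qed.

(** The derivations [T] and [T'] stand for the two directional derivatives. Factorials remain as
    multiples, since [A] need not contain their inverses. *)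
Lemma lucas_coefficients (A : idomainType) (T T' : A -> A) c (a b al be : A)
    (d : nat -> A) n :
  al != 0 -> be * a - al * b != 0 ->
  (forall x y, T (x + y) = T x + T y) ->
  (forall x y, T (x * y) = T x * y + x * T y) ->
  T a = al -> T al = 0 -> T b = be -> T be = 0 ->
  (forall x y, T' (x + y) = T' x + T' y) ->
  (forall x y, T' (x * y) = T' x * y + x * T' y) ->
  T' al = a -> T' a = 0 -> T' be = b -> T' b = 0 ->
  \sum_(r < n./2.+1)
     (d r)%:P * (al%:P + be%:P * 'X + al%:P * 'X^2) ^+ (n./2 - r)
              * (a%:P + b%:P * 'X + a%:P * 'X^2) ^+ r
    = (be * a - al * b)%:P ^+ n./2 * lucas c 'X (- (1 + 'X^2)) n ->
  forall r, (r <= n./2)%N ->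
    d r *+ r`! = (-1) ^+ r * iter r T (lucas c a b n)
    /\ d r *+ (n./2 - r)`! = (-1) ^+ r * iter (n./2 - r) T' (lucas c al be n).
Proof.
move=> al0 D0 TD TM Ta Tal Tb Tbe T'D T'M T'al T'a T'be T'b Hd.
set u := _ + _ + _ in Hd; set v := a%:P + _ + _ in Hd.
have uv : coprimep u v by apply: coprimep_forms.
have su : (1 < size u)%N.
  have : u`_2 != 0.
    by rewrite /u !coefD !coefCM coefC coefX coefXn /= ?mulr0 ?add0r ?mulr1.
  by apply: contraR; rewrite -leqNgt => s1; rewrite nth_default// (leq_trans s1).
have u0 : u != 0 by rewrite -size_poly_gt0 (ltn_trans _ su).
(* The second expansion dehomogenizes by [- v], so [v] must be nonzero. *)
have v0 : v != 0.
  apply: contraTneq uv => ->; rewrite coprimep0 -size_poly_eq1.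
  by rewrite neq_ltn su orbT.
(* The sign is attached to [v], so that its powers produce the factors [(-1) ^+ r]. *)
have lucE : lucas c (a%:P * u + al%:P * - v) (b%:P * u + be%:P * - v) n
    = (be * a - al * b)%:P ^+ n./2 * lucas c 'X (- (1 + 'X^2)) n.
  rewrite -lucas_homog; congr lucas.
    by rewrite /u /v polyCB !polyCM; ring.
  by rewrite /u /v polyCB !polyCM; ring.
have uniq (e : nat -> A) :
    lucas c (a%:P * u + al%:P * - v) (b%:P * u + be%:P * - v) n =
    \sum_(r < n./2.+1) (e r)%:P * u ^+ (n./2 - r) * v ^+ r ->
    forall r, (r <= n./2)%N -> d r = e r.
  move=> He r rn; apply/eqP; rewrite -subr_eq0; apply/eqP.
  apply: (@coprimep_form_eq0 _ u v (fun r => d r - e r) _ uv su _ r rn).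
  rewrite (eq_bigr (fun r : 'I_(n./2.+1) => (d r)%:P * u ^+ (n./2 - r) * v ^+ r
     - (e r)%:P * u ^+ (n./2 - r) * v ^+ r)); last first.
    by move=> i _; rewrite polyCB; ring.
  by rewrite sumrB Hd -He lucE subrr.
move=> r rn; split.
  set F := lucas c (a%:P + al *: 'X) (b%:P + be *: 'X) n.
  rewrite -(@lucas_taylor _ T c a al b be)// -/F.
  rewrite (uniq (fun r => (-1) ^+ r * F`_r))//; first by rewrite mulrnAr.
  rewrite (@lucas_expand A {poly A} polyC)//; apply: eq_bigr => i _.
  by rewrite [(- v) ^+ i]exprNn polyCM rmorphXn rmorphN1 /=; ring.
set F := lucas c (al%:P + a *: 'X) (be%:P + b *: 'X) n.
rewrite -(@lucas_taylor _ T' c al a be b)// -/F.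
rewrite (uniq (fun r => (-1) ^+ r * F`_(n./2 - r)))//; first by rewrite mulrnAr.
(* Swapping the summands makes [- v] the base and [u] the direction; the powers then come in reverse
   order, hence the reindexing. *)
rewrite addrC [X in lucas c _ X]addrC.
rewrite (@lucas_expand A {poly A} polyC) ?oppr_eq0//.
rewrite (reindex_inj rev_ord_inj); apply: eq_bigr => i _ /=.
rewrite subSS subKn; last by rewrite -ltnS.
by rewrite [(- v) ^+ i]exprNn polyCM rmorphXn rmorphN1 /=; ring.
Qed.

(** * The ring of rational polynomials in four variables *)

Lemma mderivXU (n : nat) (R : comNzRingType) (i j : 'I_n) :
  ('X_i : {mpoly R[n]})^`M(j) = (i == j)%:R.
Proof.
rewrite mderivX mnm1E; case: eqP => [->|_]; last by rewrite scale0r.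
by rewrite -[X in (X - _)%MM]add0m addmK mpolyX0 scale1r.
Qed.

Lemma eq_inord4 i j : (i < 4)%N -> (j < 4)%N ->
  ((inord i : 'I_4) == inord j) = (i == j).
Proof. by move=> i4 j4; rewrite -val_eqE /= !inordK. Qed.

Lemma DabD p q : Dab (p + q) = Dab p + Dab q.
Proof. by rewrite /Dab !mderivD; ring. Qed.

Lemma DabM p q : Dab (p * q) = Dab p * q + p * Dab q.
Proof. by rewrite /Dab !mderivM; ring. Qed.

Lemma DalphabetaD p q : Dalphabeta (p + q) = Dalphabeta p + Dalphabeta q.
Proof. by rewrite /Dalphabeta !mderivD; ring. Qed.

Lemma DalphabetaM p q :
  Dalphabeta (p * q) = Dalphabeta p * q + p * Dalphabeta q.
Proof. by rewrite /Dalphabeta !mderivM; ring. Qed.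

Lemma valpha_neq0 : valpha rat != 0.
Proof.
apply/eqP => /(congr1 (meval (fun=> 1)))/eqP.
by rewrite /valpha mevalXU meval0 oner_eq0.
Qed.

Lemma det_neq0 : vbeta rat * va rat - valpha rat * vb rat != 0.
Proof.
(* At [b = 0] with the other variables 1, the determinant is 1. *)
apply/eqP => /(congr1 (meval (fun i => (i != inord 1)%:R)))/eqP.
by rewrite mevalB !mevalM !mevalXU meval0 !eq_inord4//=.
Qed.

Lemma bracket_coefficients c (d : nat -> {mpoly rat[4]}) n :
  \sum_(r < n./2.+1)
     (d r)%:P
       * ((valpha rat)%:P + (vbeta rat)%:P * 'X + (valpha rat)%:P * 'X^2)
           ^+ (n./2 - r)
       * ((va rat)%:P + (vb rat)%:P * 'X + (va rat)%:P * 'X^2) ^+ r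
    = (vbeta rat * va rat - valpha rat * vb rat)%:P ^+ n./2
        * lucas c 'X (- (1 + 'X^2)) n ->
  forall r, (r <= n./2)%N ->
    d r = ((-1) ^+ r / (r`!)%:R) *: iter r Dab (lucas c (va rat) (vb rat) n)
    /\ d r = ((-1) ^+ r / ((n./2 - r)`!)%:R)
         *: iter (n./2 - r) Dalphabeta (lucas c (valpha rat) (vbeta rat) n).
Proof.
move=> Hd r rn.
have divE k (x y : {mpoly rat[4]}) : x *+ k`! = (-1) ^+ r * y ->
    x = ((-1) ^+ r / (k`!)%:R) *: y.
  have k0 : (k`!)%:R != 0 :> rat by rewrite pnatr_eq0 -lt0n fact_gt0.
  move=> E; apply: (scalerI k0); rewrite scaler_nat E scalerA mulrCA divff// mulr1.
  (* One sign is a rational scalar, the other a polynomial; both are reduced to the parity of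
     [r]. *)
  by rewrite -(signr_odd rat) -(signr_odd {mpoly rat[4]}) scaler_sign mulr_sign.
have := @lucas_coefficients _ Dab Dalphabeta c _ _ _ _ d n valpha_neq0 det_neq0
  DabD DabM _ _ _ _ DalphabetaD DalphabetaM _ _ _ _ Hd r rn.
rewrite /Dab /Dalphabeta !mderivXU !eq_inord4//= !mulr0 !mulr1 !addr0 !add0r.
by case=> // /divE E1 /divE E2; split.
Qed.

(** * From integer identities in x and y to rational ones in one variable *)

Fact toQ_zmod : zmod_morphism toQ.
Proof. exact: raddfB. Qed.

Fact toQ_monoid : monoid_morphism toQ.
Proof. by split; [exact: rmorph1 | exact: rmorphM]. Qed.

HB.instance Definition _ :=
  GRing.isZmodMorphism.Build {mpoly int[4]} {mpoly rat[4]} toQ toQ_zmod.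
HB.instance Definition _ :=
  GRing.isMonoidMorphism.Build {mpoly int[4]} {mpoly rat[4]} toQ toQ_monoid.

Lemma toQ_X i : toQ 'X_i = 'X_i.
Proof. exact: map_mpolyX. Qed.

(* Setting [x = 1] loses nothing on identities between homogeneous forms. *)
Lemma exists_specialization :
  exists phi : {rmorphism PXY int -> {poly {mpoly rat[4]}}},
    [/\ forall c, phi (cst c) = (toQ c)%:P, phi (vx int) = 1
      & phi (vy int) = 'X].
Proof.
(* The inner variable is x and the outer one y, so evaluating the coefficients at 1 sets x to 1 and
   keeps y as ['X]. *)
exists (map_poly (horner_eval 1 \o map_poly toQ)); split=> [c||].
- by rewrite /= /cst map_polyC /= map_polyC horner_evalE hornerC.
- by rewrite /= /vx map_polyC /= map_polyX horner_evalE hornerX.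
- by rewrite /= /vy map_polyX.
Qed.

Lemma specialize_sum (phi : {rmorphism PXY int -> {poly {mpoly rat[4]}}})
    (d : nat -> {mpoly int[4]}) m :
  (forall c, phi (cst c) = (toQ c)%:P) -> phi (vx int) = 1 ->
  phi (vy int) = 'X ->
  phi (\sum_(0 <= r < m + 1)
      cst (d r) * qform (valpha int) (vbeta int) ^+ (m - r)
               * qform (va int) (vb int) ^+ r)
  = \sum_(r < m.+1)
     (toQ (d r))%:P
       * ((valpha rat)%:P + (vbeta rat)%:P * 'X + (valpha rat)%:P * 'X^2)
           ^+ (m - r)
       * ((va rat)%:P + (vb rat)%:P * 'X + (va rat)%:P * 'X^2) ^+ r.
Proof.
move=> phic phix phiy.
have phiq c1 c2 : phi (qform c1 c2) =
    (toQ c1)%:P + (toQ c2)%:P * 'X + (toQ c1)%:P * 'X^2.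
  have form x y p q p' q' : phi x = 1 -> phi y = 'X ->
      phi p = p'%:P -> phi q = q'%:P ->
      phi (p * x ^+ 2 + q * x * y + p * y ^+ 2) =
      p'%:P + q'%:P * 'X + p'%:P * 'X^2.
    move=> ex ey ep eq; rewrite !expr2 !rmorphD !rmorphM ex ey ep eq.
    by rewrite !mulr1.
  exact: form.
have term p q e k l p' q' e' : phi p = p' -> phi q = q' -> phi e = e' ->
    phi (p * q ^+ k * e ^+ l) = p' * q' ^+ k * e' ^+ l.
  by move=> <- <- <-; rewrite 2!rmorphM 2!rmorphXn.
rewrite addn1 big_mkord (rmorph_sum phi); apply: eq_bigr => r _.
rewrite /va /vb /valpha /vbeta -!toQ_X.
apply: term; [exact: phic | exact: phiq | exact: phiq].
Qed.

Lemma oneDX_neq0 (R : nzRingType) : 1 + 'X != 0 :> {poly R}.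
Proof. by rewrite addrC -polyC1 monic_neq0// monicXaddC. Qed.

Lemma oneBX_neq0 (R : nzRingType) : 1 - 'X != 0 :> {poly R}.
Proof. by rewrite -oppr_eq0 opprB -polyC1 monic_neq0// monicXsubC. Qed.

Theorem theorem8p4 (n : nat) (hn : (1 <= n)%N) :
  (forall cPsi : nat -> {mpoly int[4]}, is_Psi_bracket n cPsi ->
   forall r : nat, (r <= n./2)%N ->
     toQ (cPsi r)
       = ((-1) ^+ r / (r`!)%:R) *: iter r Dab (Psi (va rat) (vb rat) n)
     /\ toQ (cPsi r)
       = ((-1) ^+ r / ((n./2 - r)`!)%:R)
           *: iter (n./2 - r) Dalphabeta (Psi (valpha rat) (vbeta rat) n))
  /\
  (forall cPhi : nat -> {mpoly int[4]}, is_Phi_bracket n cPhi ->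
   forall r : nat, (r <= (n.-1)./2)%N ->
     toQ (cPhi r)
       = ((-1) ^+ r / (r`!)%:R) *: iter r Dab (Phi (va rat) (vb rat) n)
     /\ toQ (cPhi r)
       = ((-1) ^+ r / (((n.-1)./2 - r)`!)%:R)
           *: iter ((n.-1)./2 - r) Dalphabeta (Phi (valpha rat) (vbeta rat) n)).
Proof.
have [phi [phic phix phiy]] := exists_specialization.
have phi_det : phi (cst (vbeta int * va int - valpha int * vb int))
    = (vbeta rat * va rat - valpha rat * vb rat)%:P.
  by rewrite phic rmorphB !rmorphM /= !toQ_X.
split=> d Hd.
  rewrite !PsiE; apply: (@bracket_coefficients _ (fun r => toQ (d r))).
  have X0 := expf_neq0 (delta n) (oneDX_neq0 {mpoly rat[4]}).
  (* Multiplying by the nonzero power of [1 + 'X] restores the cleared form of the defining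
     identity. *)
  apply: (mulfI X0).
  have spec D x y S m D' S' : phi x = 1 -> phi y = 'X ->
      phi D = D' -> phi S = S' ->
      D ^+ m * (x ^+ n + y ^+ n) = (x + y) ^+ delta n * S ->
      (1 + 'X) ^+ delta n * S' = D' ^+ m * (1 + 'X^n).
    move=> ex ey <- <- /(congr1 phi).
    rewrite 2!rmorphM 2!rmorphXn 2!rmorphD 2!rmorphXn ex ey => <-.
    by rewrite expr1n.
  rewrite (spec _ _ _ _ _ _ _ phix phiy phi_det
             (@specialize_sum phi d n./2 phic phix phiy) Hd).
  rewrite mulrCA; congr (_ * _).
  (* The sums [1 + 'X^k] start at 2, which is the value of [lucas 2] at 0. *)
  have := @lucas_xy _ 2 1 ('X : {poly {mpoly rat[4]}}) 1 (fun k => 1 + 'X^k) n.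
  rewrite !mul1r expr1n => ->//; first by rewrite expr0 mulr1.
    by rewrite mulr1.
  by move=> k; rewrite !exprS; ring.
case: n hn Hd => // n _ Hd.
rewrite !PhiE; apply: (@bracket_coefficients _ (fun r => toQ (d r))).
have X0 := mulf_neq0 (oneBX_neq0 {mpoly rat[4]})
             (expf_neq0 (delta n) (oneDX_neq0 {mpoly rat[4]})).
apply: (mulfI X0).
have spec D x y S m D' S' : phi x = 1 -> phi y = 'X ->
    phi D = D' -> phi S = S' ->
    D ^+ m * (x ^+ n.+1 - y ^+ n.+1) = (x - y) * (x + y) ^+ delta n * S ->
    (1 - 'X) * (1 + 'X) ^+ delta n * S' = D' ^+ m * (1 - 'X^(n.+1)).
  move=> ex ey <- <- /(congr1 phi).
  rewrite 3!rmorphM 2!rmorphXn 2!rmorphB rmorphD 2!rmorphXn ex ey => <-.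
  by rewrite expr1n.
rewrite (spec _ _ _ _ _ _ _ phix phiy phi_det
           (@specialize_sum phi d n./2 phic phix phiy) Hd).
rewrite mulrCA; congr (_ * _).
(* The exponent [k.+1] matches the index shift of [PhiE]: the sequence starts at [1 - 'X], which is
   [z] itself. *)
have := @lucas_xy _ 1 1 ('X : {poly {mpoly rat[4]}}) (1 - 'X) (fun k => 1 - 'X^(k.+1)) n.
rewrite !mul1r expr1n => ->//; first by ring.
by move=> k; rewrite !exprS; ring.
Qed.
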